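(* Let $F$ be $\mathbb R$ or $\mathbb C$, and let $*_\mu$ be a multiplication on the space $\mathfrak C$ of $m\times m\times m$ cubic matrices over $F$ such that the algebra $\mathfrak C_\mu=(\mathfrak C,*_\mu)$ is power-associative, unital with unit matrix $\mathbb I$, associative, and is a normed space with a norm $\lVert\cdot\rVert$ satisfying $\lVert A*_\mu B\rVert\le\lVert A\rVert\,\lVert B\rVert$ for any two cubic matrices $A,B$. Let $Q$ be a cubic matrix. Then the family of matrices $\mathcal M^{[s,t]}=\exp_\mu((t-s)Q)$, $0\le s<t$, generates a time-homogeneous flow of algebras (FA) of type $\mu$.
   Context: A cubic matrix over $F$ is an array $Q=(q_{ijk})_{i,j,k=1}^m$ with entries in $F$; $\mathfrak C$ is the $m^3$-dimensional vector space of all of them (entrywise operations). A multiplication $*_\mu$ on $\mathfrak C$ is an arbitrary $F$-bilinear map $\mathfrak C\times\mathfrak C\to\mathfrak C$, and $\mathfrak C_\mu=(\mathfrak C,*_\mu)$ is the resulting algebra. An algebra is power-associative if for each element the subalgebra generated by it is associative; it is unital if it has an element $u$ with $ux=x=xu$ for all $x$. Powers: $Q^{*_\mu n}=\underbrace{Q*_\mu\cdots*_\mu Q}_{n\text{ times}}$ for $n\ge1$ and $Q^{*_\mu 0}=\mathbb I$. The matrix exponent is $\exp_\mu(tQ)=\sum_{n\ge0}\frac{(tQ)^{*_\mu n}}{n!}$ (entrywise sum). A family of cubic matrices $\mathcal M^{[s,t]}=(c^{[s,t]}_{ijk})_{i,j,k=1}^m$, $0\le s<t$ real, generates an FA (flow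 of algebras) of type $\mu$ if it satisfies the Kolmogorov-Chapman equation $\mathcal M^{[s,t]}=\mathcal M^{[s,\tau]}*_\mu\mathcal M^{[\tau,t]}$ for all $0\le s<\tau<t$; the FA is then the family of $m$-dimensional algebras $\mathcal A^{[s,t]}$ over $F$ with basis $e_1,\dots,e_m$ and products $e_ie_j=\sum_{k=1}^m c^{[s,t]}_{ijk}e_k$. The FA is time-homogeneous if $\mathcal M^{[s,t]}$ depends only on $t-s$. *)

(* Defs.v *)
From HB Require Import structures.
From mathcomp Require Import all_boot all_order all_algebra.
From mathcomp Require Import all_classical all_reals all_analysis.
From mathcomp Require Import complex.

Set Implicit Arguments.
Unset Strict Implicit.
Unset Printing Implicit Defensive.

Import Order.TTheory GRing.Theory Num.Theory.
Import numFieldNormedType.Exports.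

Local Open Scope classical_set_scope.
Local Open Scope ring_scope.

Variant ground := RealGround | ComplexGround.

Definition ground_field (R : realType) (g : ground) : numFieldType :=
  match g with RealGround => R | ComplexGround => R[i] end.

Definition of_real (R : realType) (g : ground) : R -> ground_field R g :=
  match g with RealGround => fun x => x | ComplexGround => real_complex R end.

(* The entry q_ijk of Q is Q (i, j, k).  The exponent ^o only makes the field
   a module over itself, so that cubic matrices form an F-vector space. *)
Definition cubic (F : numFieldType) (m : nat) : Type :=
  {ffun 'I_m * 'I_m * 'I_m -> F^o}.

Notation cubic_mul F m :=
  {bilinear cubic F m -> cubic F m -> cubic F m}.

Section Algebra.
Variables (F : numFieldType) (m : nat) (mu : cubic_mul F m).

Definition is_subalgebra (S : set (cubic F m)) : Prop :=
  [/\ S 0,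
      forall (a : F) x y, S x -> S y -> S (a *: x + y) &
      forall x y, S x -> S y -> S (mu x y)].

Definition generated_subalgebra (x : cubic F m) : set (cubic F m) :=
  smallest is_subalgebra [set x].

Definition power_associative : Prop :=
  forall x a b c, generated_subalgebra x a -> generated_subalgebra x b ->
    generated_subalgebra x c -> mu (mu a b) c = mu a (mu b c).

Definition is_unit_matrix (I : cubic F m) : Prop :=
  forall x, mu I x = x /\ mu x I = x.

(* [iterop n mu Q I] is Q *mu (... *mu Q) with n factors, and I for n = 0. *)
Definition mu_pow (I Q : cubic F m) (n : nat) : cubic F m := iterop n mu Q I.

Definition mu_exp_sum (I Q : cubic F m) (n : nat) : cubic F m :=
  \sum_(k < n) (k`!%:R : F)^-1 *: mu_pow I Q k.

Definition mu_exp_cvg (I Q : cubic F m) : Prop :=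
  forall i j k, cvgn (fun n => mu_exp_sum I Q n (i, j, k) : F).

(* Meaningful only under [mu_exp_cvg I Q], [limn] being a total operator. *)
Definition mu_exp (I Q : cubic F m) : cubic F m :=
  [ffun p => limn (fun n => mu_exp_sum I Q n p : F)].

End Algebra.

Section Norm.
Variables (R : realType) (g : ground) (m : nat).
Let F := ground_field R g.

Definition is_norm (N : cubic F m -> R) : Prop :=
  [/\ forall x, 0 <= N x,
      forall x, N x = 0 -> x = 0,
      forall x y, N (x + y) <= N x + N y &
      (* MathComp moduli are elements of F, hence the embeddings [of_real] *)
      forall (a : F) x, of_real g (N (a *: x)) = `|a| * of_real g (N x)].

Definition submultiplicative (mu : cubic_mul F m) (N : cubic F m -> R) : Prop :=
  forall x y, N (mu x y) <= N x * N y.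

End Norm.

Section Flow.
Variables (R : realType) (F : numFieldType) (m : nat).

(* Families are total in (s, t); only the values with 0 <= s < t matter. *)
Implicit Types (M : R -> R -> cubic F m).

Definition kolmogorov_chapman (mu : cubic_mul F m) M : Prop :=
  forall s tau t, 0 <= s -> s < tau -> tau < t ->
    M s t = mu (M s tau) (M tau t).

(* Algebras on F^m; the basis vector e_i is [delta_mx 0 i]. *)
Definition algebra_product : Type :=
  {bilinear 'rV[F]_m -> 'rV[F]_m -> 'rV[F]_m}.

Definition has_structure_matrix (A : algebra_product) (c : cubic F m) : Prop :=
  forall i j, A (delta_mx 0 i) (delta_mx 0 j) =
    \sum_(k < m) (c (i, j, k) : F) *: delta_mx 0 k.

Definition flow_of_algebras (mu : cubic_mul F m) M
    (A : R -> R -> algebra_product) : Prop :=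
  kolmogorov_chapman mu M /\
  forall s t, 0 <= s -> s < t -> has_structure_matrix (A s t) (M s t).

Definition time_homogeneous M : Prop :=
  forall s t s' t', 0 <= s -> s < t -> 0 <= s' -> s' < t' ->
    t - s = t' - s' -> M s t = M s' t'.

Definition generates_time_homogeneous_FA (mu : cubic_mul F m) M : Prop :=
  (exists A : R -> R -> algebra_product, flow_of_algebras mu M A) /\
  time_homogeneous M.

End Flow.

(* Main.v *)
Require Import Defs.
From HB Require Import structures.
From mathcomp Require Import all_boot all_order all_algebra.
From mathcomp Require Import all_classical all_reals all_analysis.
From mathcomp Require Import complex.
From mathcomp Require Import ring.

Set Implicit Arguments.
Unset Strict Implicit.
Unset Printing Implicit Defensive.

Import Order.TTheory GRing.Theory Num.Theory.
Import numFieldNormedType.Exports.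

Local Open Scope classical_set_scope.
Local Open Scope ring_scope.

(* In finite dimension a bilinear multiplication is bounded for the l^1 norm of
   the entries, so the entries of Q^n are O(K^n) for some K and the exponential
   series converges entrywise by comparison with exp.  Let E_n(a) be the n-th
   partial sum of exp(aQ).  Then E_n(a) * E_n(b) - E_n(a + b) consists of the
   terms a^i b^j Q^(i + j) / (i! j!) with i, j < n <= i + j.  Entrywise it is
   dominated by the same expression for the scalars |a|, |b|, K in place of
   a, b, Q, namely
   e_n(|a|K) e_n(|b|K) - e_n((|a| + |b|)K) with e_n(x) = sum_(k<n) x^k/k!,
   which tends to 0 by the functional equation of the real exponential. *)

(** * Transfer between the reals and the ground field *)

Section GroundField.
Variables (R : realType).

Fact of_real_zmod (g : ground) : zmod_morphism (@of_real R g).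
Proof. case: g => x y //=; exact: raddfB. Qed.

Fact of_real_monoid (g : ground) : monoid_morphism (@of_real R g).
Proof. case: g; split=> //= x y; exact: rmorphM. Qed.

HB.instance Definition _ (g : ground) :=
  GRing.isZmodMorphism.Build R (ground_field R g) _ (@of_real_zmod g).
HB.instance Definition _ (g : ground) :=
  GRing.isMonoidMorphism.Build R (ground_field R g) _ (@of_real_monoid g).

Lemma ler_of_real (g : ground) (x y : R) :
  (of_real g x <= of_real g y) = (x <= y).
Proof. case: g => //=; exact: lecR. Qed.

Lemma norm_of_real (g : ground) (x : R) : `|of_real g x| = of_real g `|x|.
Proof. by case: g => //=; rewrite normc_def /= expr0n addr0 sqrtr_sqr. Qed.

(** A nonnegative element of [R[i]] is real by the definition of the order. Through this, bounds and
    tolerances found in the ground field are pulled back to [R]. *)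
Lemma ge0_of_realP (g : ground) (x : ground_field R g) :
  0 <= x -> exists r, x = of_real g r.
Proof.
case: g x => /= [x _|x x0]; first by exists x.
by have /complex_realP[r ->] := ger0_real x0; exists r.
Qed.

Lemma cvgn_of_real (g : ground) (v : R^nat) (l : R) :
  v @ \oo --> l ->
  (fun n => of_real g (v n) : ground_field R g) @ \oo -->
  (of_real g l : ground_field R g).
Proof.
move=> /cvgrPdist_le vl; apply/cvgrPdist_le => e e0.
have [r er] := ge0_of_realP (ltW e0).
have r0 : 0 < r by rewrite ltNge -(ler_of_real g) rmorph0 -er lt_geF.
apply: filterS (vl r r0) => n /= vn.
by rewrite -rmorphB norm_of_real er ler_of_real.
Qed.

Lemma normc_ge_Im (z : R[i]) : `|complex.Im z|%:C%C <= `|z|.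
Proof.
case: z => a b; rewrite normc_def lecR /= -[leLHS]sqrtr_sqr.
by rewrite ler_wsqrtr // lerDr sqr_ge0.
Qed.

(** Comparison test. Over the complex numbers it is applied to the real and imaginary parts, whose
    absolute values are at most the modulus, and the two limits are recombined. *)
Lemma dominated_series_cvg (g : ground) (f : nat -> ground_field R g)
    (v : R^nat) :
  (forall n, `|f n| <= of_real g (v n)) -> cvgn (series v) -> cvgn (series f).
Proof.
have real_case (h w : R^nat) :
    (forall n, `|h n| <= w n) -> cvgn (series w) -> cvgn (series h).
  move=> hw cw; apply: normed_cvg; apply: (series_le_cvg _ _ hw cw) => n //.
  exact: le_trans (hw n).
case: g f => /= [f fv|f fv cv]; first exact: real_case.
have cRe : cvgn (series (fun n => complex.Re (f n))).
  apply: (real_case _ v) => // n; rewrite -lecR.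
  exact: le_trans (normc_ge_Re _) (fv n).
have cIm : cvgn (series (fun n => complex.Im (f n))).
  apply: (real_case _ v) => // n; rewrite -lecR.
  exact: le_trans (normc_ge_Im _) (fv n).
rewrite (_ : series f = fun n =>
    of_real ComplexGround (series (fun k => complex.Re (f k)) n) +
    'i%C * of_real ComplexGround (series (fun k => complex.Im (f k)) n)).
  have iIm := cvgMl_tmp (a := 'i%C : ground_field R ComplexGround)
    (cvgn_of_real (g := ComplexGround) cIm).
  exact: cvgP (cvgD (cvgn_of_real (g := ComplexGround) cRe) (iIm _)).
apply/funext => n; rewrite /series !rmorph_sum mulr_sumr -big_split /=.
by apply: eq_bigr => k _; exact: complexE.
Qed.

End GroundField.

(** * Products of truncated exponential sums *)

Lemma sum_antidiagonals (V : nmodType) (f : nat -> nat -> V) n :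
  \sum_(i < n) \sum_(j < n | (i + j < n)%N) f i j =
  \sum_(k < n) \sum_(i < k.+1) f i (k - i)%N.
Proof.
transitivity (\sum_(k < n) \sum_(i < n | (i <= k)%N) f i (k - i)%N); last first.
  apply: eq_bigr => k _.
  by rewrite (big_ord_widen_cond n xpredT (fun i => f i (k - i)%N)).
rewrite [RHS](exchange_big_dep xpredT) //=; apply: eq_bigr => i _.
rewrite -(big_mkord (fun j => (i + j < n)%N)).
rewrite -(big_mkord (fun k => (i <= k)%N) (fun k => f i (k - i)%N)).
(* For fixed i, the range i <= k < n becomes j < n - i under k = i + j, then j < n restricted by i +
   j < n. *)
rewrite -[RHS](big_nat_widenl i 0 n xpredT) //.
rewrite -[X in _ = \big[_/_]_(X <= _ < _) _]add0n big_addn.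
rewrite [RHS](big_nat_widen 0 (n - i) n) ?leq_subr //.
apply: eq_big => [j|j _]; last by rewrite addnK.
by rewrite /= ltn_subRL.
Qed.

Lemma exprD_fact (F : numFieldType) (a b : F) k :
  (a + b) ^+ k / k`!%:R =
  \sum_(i < k.+1) (a ^+ i / i`!%:R) * (b ^+ (k - i) / (k - i)`!%:R).
Proof.
rewrite addrC exprDn mulr_suml; apply: eq_bigr => i _.
have ik : (i <= k)%N by rewrite -ltnS.
have fact_neq0 n : n`!%:R != 0 :> F by rewrite pnatr_eq0 -lt0n fact_gt0.
(* Expanding k! as 'C(k, i) * (i! * (k - i)!) leaves an identity of fractions with nonzero
   denominators. *)
rewrite -mulr_natr -(bin_fact ik) !natrM.
have := bin_gt0 k i; rewrite ik => C0.
by field; rewrite !fact_neq0 pnatr_eq0 -lt0n C0.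
Qed.

(** The pairs with i + j < n, grouped by k = i + j, recombine by the binomial formula. The weight z
    is arbitrary so that it can stand both for an entry of Q^k and for its majorant K^k. *)
Lemma exp_product_split (F : numFieldType) (a b : F) (z : nat -> F) n :
  \sum_(i < n) \sum_(j < n)
     (a ^+ i / i`!%:R) * (b ^+ j / j`!%:R) * z (i + j)%N =
  \sum_(k < n) (a + b) ^+ k / k`!%:R * z k +
  \sum_(i < n) \sum_(j < n | ~~ (i + j < n)%N)
     (a ^+ i / i`!%:R) * (b ^+ j / j`!%:R) * z (i + j)%N.
Proof.
pose f i j := (a ^+ i / i`!%:R) * (b ^+ j / j`!%:R) * z (i + j)%N.
have -> : \sum_(k < n) (a + b) ^+ k / k`!%:R * z k =
    \sum_(i < n) \sum_(j < n | (i + j < n)%N) f i j.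
  rewrite sum_antidiagonals; apply: eq_bigr => k _.
  rewrite exprD_fact mulr_suml; apply: eq_bigr => i _.
  by rewrite /f subnKC // -ltnS.
rewrite -big_split; apply: eq_bigr => i _.
by rewrite (bigID (fun j : 'I_n => (i + j < n)%N)).
Qed.

(** * Coordinates and boundedness of the multiplication *)

Section Cubic.
Variables (F : numFieldType) (m : nat) (mu : cubic_mul F m).
Implicit Types (x y Q : cubic F m) (p q r : 'I_m * 'I_m * 'I_m).

Definition cubic_unit q : cubic F m := [ffun p => (p == q)%:R].

Lemma cubic_sum_unit x : x = \sum_q (x q : F) *: cubic_unit q.
Proof.
apply/ffunP => p; rewrite sum_ffunE (bigD1 p) //= !ffunE eqxx big1 ?addr0.
  by rewrite [RHS]mulr1.
by move=> q qp; rewrite !ffunE eq_sym (negbTE qp) scaler0.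
Qed.

Lemma cubic_mulE x y p :
  mu x y p = \sum_q \sum_r
    (x q : F) * (y r : F) * (mu (cubic_unit q) (cubic_unit r) p : F) :> F.
Proof.
rewrite {1}(cubic_sum_unit x) linear_sumlz sum_ffunE; apply: eq_bigr => q _.
rewrite linearZl_LR {1}(cubic_sum_unit y) linear_sumr ffunE sum_ffunE.
rewrite scaler_sumr.
by apply: eq_bigr => r _; rewrite linearZr_LR ffunE scalerA.
Qed.

(* The outer cast makes the sum live in F itself, not in the ordered Z-module
   that the norm notation infers. *)
Definition l1norm x : F := \sum_p (`|x p : F| : F).

Lemma l1norm_ge0 x : 0 <= l1norm x.
Proof. exact: sumr_ge0. Qed.

Lemma ler_l1norm x p : `|x p : F| <= l1norm x.
Proof. by rewrite /l1norm (bigD1 p) //= lerDl sumr_ge0. Qed.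

(** The constant is the sum of the norms of all products of two basis elements, so it dominates each
    of them. *)
Lemma cubic_mul_bounded :
  exists2 C : F, 0 <= C &
    forall x y, l1norm (mu x y) <= C * (l1norm x * l1norm y).
Proof.
pose c q r := mu (cubic_unit q) (cubic_unit r).
pose C : F := \sum_q \sum_r l1norm (c q r).
have ge0_sum q : 0 <= \sum_r l1norm (c q r).
  by apply: sumr_ge0 => r _; exact: l1norm_ge0.
have C0 : 0 <= C by exact: sumr_ge0.
have c_le q r : l1norm (c q r) <= C.
  rewrite /C (bigD1 q) //= (bigD1 r) //= -addrA lerDl.
  rewrite addr_ge0 ?sumr_ge0 // => *; exact: l1norm_ge0.
exists C => // x y.
apply: (@le_trans _ _
  (\sum_p \sum_q \sum_r `|x q : F| * `|y r : F| * `|c q r p : F|)).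
  apply: ler_sum => p _; rewrite cubic_mulE.
  apply: le_trans (ler_norm_sum _ _ _) _; apply: ler_sum => q _.
  apply: le_trans (ler_norm_sum _ _ _) _; apply: ler_sum => r _.
  by rewrite !normrM.
(* With the sum over p moved innermost, it becomes [l1norm (c q r)], which is at most C. *)
rewrite exchange_big mulrC [l1norm x * _]big_distrlr mulr_suml.
apply: ler_sum => q _; rewrite exchange_big mulr_suml.
by apply: ler_sum => r _; rewrite -mulr_sumr ler_wpM2l ?mulr_ge0 ?c_le.
Qed.

(** * Powers and partial sums of the exponential *)

Variable (I : cubic F m).
Hypothesis I_unit : is_unit_matrix mu I.
Hypothesis mu_assoc : associative mu.

Lemma mu_powS Q n : mu_pow mu I Q n.+1 = mu Q (mu_pow mu I Q n).
Proof. by case: n => [|n] //; rewrite /mu_pow /= (I_unit Q).2. Qed.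

Lemma mu_powD Q i j :
  mu_pow mu I Q (i + j) = mu (mu_pow mu I Q i) (mu_pow mu I Q j).
Proof.
elim: i => [|i IHi]; first by rewrite (I_unit _).1.
by rewrite addSn !mu_powS IHi mu_assoc.
Qed.

Lemma mu_powZ (a : F) Q n : mu_pow mu I (a *: Q) n = a ^+ n *: mu_pow mu I Q n.
Proof.
elim: n => [|n IHn]; first by rewrite scale1r.
by rewrite !mu_powS IHn linearZl_LR linearZr_LR scalerA exprS.
Qed.

(** Each multiplication by Q costs a factor K = C * [l1norm Q], and D = [l1norm I] accounts for the
    power 0. *)
Lemma mu_pow_bounded Q :
  exists D K : F, [/\ 0 <= D, 0 <= K &
    forall n p, `|mu_pow mu I Q n p : F| <= D * K ^+ n].
Proof.
have [C C0 mu_le] := cubic_mul_bounded.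
exists (l1norm I), (C * l1norm Q).
have K0 : 0 <= C * l1norm Q by rewrite mulr_ge0 ?l1norm_ge0.
split; [exact: l1norm_ge0 | exact: K0 | move=> n p].
apply: le_trans (ler_l1norm _ p) _.
elim: n => [|n IHn]; first by rewrite mulr1.
rewrite mu_powS; apply: le_trans (mu_le _ _) _.
by rewrite exprS [leRHS]mulrCA mulrA ler_wpM2l.
Qed.

Lemma mu_exp_sumZE (a : F) Q n p :
  mu_exp_sum mu I (a *: Q) n p =
  \sum_(k < n) a ^+ k / k`!%:R * (mu_pow mu I Q k p : F) :> F.
Proof.
rewrite /mu_exp_sum sum_ffunE; apply: eq_bigr => k _.
by rewrite mu_powZ scalerA ffunE [_^-1 * _]mulrC.
Qed.

(** Associativity merges the two powers of Q into one, which gives the shape required by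
    [exp_product_split]. *)
Lemma mu_exp_sumM (a b : F) Q n p :
  mu (mu_exp_sum mu I (a *: Q) n) (mu_exp_sum mu I (b *: Q) n) p =
  \sum_(i < n) \sum_(j < n)
    (a ^+ i / i`!%:R) * (b ^+ j / j`!%:R) * (mu_pow mu I Q (i + j) p : F) :> F.
Proof.
rewrite /mu_exp_sum linear_sumlz sum_ffunE; apply: eq_bigr => i _.
rewrite linear_sumr sum_ffunE; apply: eq_bigr => j _.
rewrite linearZl_LR linearZr_LR !mu_powZ linearZl_LR linearZr_LR.
rewrite !scalerA mu_powD ffunE.
by congr (_ * _); rewrite [RHS]mulrACA mulrC [b ^+ _ * _]mulrC; ring.
Qed.

Lemma mu_exp_sum_defect (a b : F) Q :
  exists D K : F, [/\ 0 <= D, 0 <= K & forall n p,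
  `|(mu (mu_exp_sum mu I (a *: Q) n) (mu_exp_sum mu I (b *: Q) n) p : F) -
    (mu_exp_sum mu I ((a + b) *: Q) n p : F)| <=
  D * ((\sum_(i < n) (`|a| * K) ^+ i / i`!%:R) *
       (\sum_(j < n) (`|b| * K) ^+ j / j`!%:R) -
       \sum_(k < n) ((`|a| + `|b|) * K) ^+ k / k`!%:R)].
Proof.
have [D [K [D0 K0 pow_le]]] := mu_pow_bounded Q.
exists D, K; split=> // n p.
rewrite mu_exp_sumM mu_exp_sumZE.
(* The subtraction cancels the pairs with i + j < n, leaving those with n <= i + j. *)
rewrite (exp_product_split a b (fun k => mu_pow mu I Q k p)).
rewrite [X in X - _]addrC addrK.
have expE (t : F) :
    \sum_(k < n) (t * K) ^+ k / k`!%:R =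
    \sum_(k < n) t ^+ k / k`!%:R * K ^+ k.
  by apply: eq_bigr => k _; rewrite exprMn mulrAC.
have -> : (\sum_(i < n) (`|a| * K) ^+ i / i`!%:R) *
    (\sum_(j < n) (`|b| * K) ^+ j / j`!%:R) =
    \sum_(i < n) \sum_(j < n)
      (`|a| ^+ i / i`!%:R) * (`|b| ^+ j / j`!%:R) * K ^+ (i + j).
  rewrite big_distrlr /=; apply: eq_bigr => i _; apply: eq_bigr => j _.
  by rewrite !exprMn exprD; ring.
(* The same splitting with weight K^k reduces the bound to the same pairs, so the comparison is
   termwise. *)
rewrite expE (exp_product_split `|a| `|b|) [X in _ * (X - _)]addrC addrK.
rewrite mulr_sumr.
apply: le_trans (ler_norm_sum _ _ _) _; apply: ler_sum => i _.
rewrite mulr_sumr.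
apply: le_trans (ler_norm_sum _ _ _) _; apply: ler_sum => j _.
by rewrite !normrM !normfV !normrX !normr_nat [leRHS]mulrCA ler_wpM2l.
Qed.

(** Each entry of a product is a fixed polynomial in the entries of the factors. *)
Lemma cvgn_cubic_mul (u v : nat -> cubic F m) x y :
  (forall p, (fun n => u n p : F) @ \oo --> (x p : F)) ->
  (forall p, (fun n => v n p : F) @ \oo --> (y p : F)) ->
  forall p, (fun n => mu (u n) (v n) p : F) @ \oo --> (mu x y p : F).
Proof.
move=> ux vy p; rewrite cubic_mulE.
under [X in X @ _ --> _]funext => n do rewrite cubic_mulE.
apply: cvg_big => [|q _]; first exact: add_continuous.
apply: cvg_big => [|r _]; first exact: add_continuous.
apply: cvgMr_tmp; apply: cvgM; [exact: ux | exact: vy].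
Qed.

End Cubic.

(** * The algebra with given structure constants *)

Section StructureAlgebra.
Variables (F : numFieldType) (m : nat) (c : cubic F m).

(** The bilinear extension of the multiplication table of the basis; it provides an algebra for
    every cubic matrix. *)
Definition structure_product (x y : 'rV[F]_m) : 'rV[F]_m :=
  \row_k \sum_i \sum_j x 0 i * y 0 j * (c (i, j, k) : F).

Fact structure_product_is_bilinear :
  bilinear_for *:%R *:%R structure_product.
Proof.
split=> z a x y; apply/rowP => k; rewrite !mxE mulr_sumr -big_split /=;
  apply: eq_bigr => i _; rewrite mulr_sumr -big_split /=; apply: eq_bigr => j _;
  rewrite !mxE; ring.
Qed.

HB.instance Definition _ :=
  bilinear_isBilinear.Build F 'rV[F]_m 'rV[F]_m 'rV[F]_m *:%R *:%R
    structure_product structure_product_is_bilinear.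

Lemma structure_product_matrix : has_structure_matrix structure_product c.
Proof.
move=> i j; apply/rowP => k; rewrite mxE summxE.
rewrite (bigD1 i) //= (bigD1 j) //= [RHS](bigD1 k) //=.
rewrite !mxE !eqxx /= !mul1r mulr1 !big1 ?addr0 // => [k' kk'|i' ii'|j' jj'].
- by rewrite !mxE eqxx [_ == k']eq_sym (negbTE kk') mulr0.
- by rewrite big1 // => j' _; rewrite mxE eqxx (negbTE ii') !mul0r.
- by rewrite !mxE eqxx (negbTE jj') !(mulr0, mul0r).
Qed.

End StructureAlgebra.

(** * Convergence and the addition formula *)

Section Exponential.
Variables (R : realType) (g : ground) (m : nat).
Let F := ground_field R g.
Variables (mu : cubic_mul F m) (I : cubic F m).
Hypothesis I_unit : is_unit_matrix mu I.
Hypothesis mu_assoc : associative mu.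

(** As [mu_exp] is defined by [limn], the claim amounts to convergence of the series, with majorant
    d * k^n / n!. *)
Lemma mu_exp_cvgE Q p :
  (fun n => mu_exp_sum mu I Q n p : F) @ \oo --> (mu_exp mu I Q p : F).
Proof.
rewrite /mu_exp ffunE.
have [D [K [D0 K0 pow_le]]] := mu_pow_bounded I_unit Q.
have [d dE] := ge0_of_realP D0; have [k kE] := ge0_of_realP K0.
rewrite (_ : (fun n => _) =
    series (fun n => n`!%:R^-1 * (mu_pow mu I Q n p : F))); last first.
  apply/funext => n; rewrite /mu_exp_sum sum_ffunE /series /= big_mkord.
  by apply: eq_bigr => i _; rewrite ffunE.
apply: (@dominated_series_cvg _ _ _ (fun n => d * exp_coeff k n)).
  move=> n; rewrite normrM normfV normr_nat mulrC /exp_coeff /= mulrA.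
  rewrite !rmorphM rmorphXn fmorphV rmorph_nat /= -dE -kE.
  by rewrite ler_wpM2r ?invr_ge0.
exact: (@is_cvg_seriesZ R (exp_coeff k) d (is_cvg_series_exp_coeff k)).
Qed.

Lemma of_real_exp_sum (x : R) n :
  \sum_(k < n) of_real g x ^+ k / k`!%:R = of_real g (series (exp_coeff x) n).
Proof.
rewrite /series /= big_mkord rmorph_sum; apply: eq_bigr => k _.
by rewrite rmorphM rmorphXn fmorphV rmorph_nat.
Qed.

Lemma mu_expD (x y : R) Q : 0 <= x -> 0 <= y ->
  mu_exp mu I (of_real g (x + y) *: Q) =
  mu (mu_exp mu I (of_real g x *: Q)) (mu_exp mu I (of_real g y *: Q)).
Proof.
move=> x0 y0; apply/ffunP => p.
pose E (a : F) n := mu_exp_sum mu I (a *: Q) n.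
pose u n : F := mu (E (of_real g x) n) (E (of_real g y) n) p.
pose w n : F := E (of_real g (x + y)) n p.
have uP : u @ \oo --> (mu (mu_exp mu I (of_real g x *: Q))
    (mu_exp mu I (of_real g y *: Q)) p : F).
  by apply: cvgn_cubic_mul => q; exact: mu_exp_cvgE.
have wP : w @ \oo --> (mu_exp mu I (of_real g (x + y) *: Q) p : F).
  exact: mu_exp_cvgE.
(* Uniqueness of limits equates 0 with the difference of the two limits. *)
suff uw0 : (u \- w) @ \oo --> (0 : F).
  apply/eqP; rewrite eq_sym -subr_eq0; apply/eqP.
  exact: (cvg_unique (@norm_hausdorff _ _) (cvgB uP wP) uw0).
have [D [K [D0 K0 defect]]] :=
  mu_exp_sum_defect I_unit mu_assoc (of_real g x) (of_real g y) Q.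
have [d dE] := ge0_of_realP D0; have [k kE] := ge0_of_realP K0.
pose e (z : R) := series (exp_coeff (z * k)).
have e_cvg z : e z @ \oo --> expR (z * k) by exact: is_cvg_series_exp_coeff.
(* This is the bound in [defect] read in [R]; it vanishes in the limit because [expR] turns sums
   into products. *)
pose v n := d * (e x n * e y n - e (x + y) n).
have v0 : v @ \oo --> (0 : R).
  have -> : 0 = d * (expR (x * k) * expR (y * k) - expR ((x + y) * k)).
    by rewrite mulrDl expRD subrr mulr0.
  apply: cvgMl_tmp; apply: cvgB => //; exact: cvgM.
have := cvgn_of_real (g := g) v0; rewrite rmorph0 => /cvgr0Pnorm_le v0F.
apply/cvgr0Pnorm_le => eps eps0; apply: filterS (v0F eps eps0) => n.
apply: le_trans; rewrite norm_of_real.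
apply: (@le_trans _ _ (of_real g (v n))); last by rewrite ler_of_real ler_norm.
rewrite /u /w /E rmorphD; apply: le_trans (defect n p) _.
(* Here x, y >= 0 replaces |x| and |y| by x and y, so that |x| + |y| becomes x + y as in [v]. *)
rewrite !norm_of_real !ger0_norm // kE dE -rmorphD -!rmorphM !of_real_exp_sum.
by rewrite -rmorphM -rmorphB -rmorphM.
Qed.

End Exponential.

(** * The flow generated by the exponential *)

Theorem theorem1 (R : realType) (g : ground) (m : nat)
    (mu : cubic_mul (ground_field R g) m) (I : cubic (ground_field R g) m)
    (N : cubic (ground_field R g) m -> R)
    (mu_power_assoc : power_associative mu)
    (mu_unital : is_unit_matrix mu I)
    (mu_assoc : associative mu)
    (N_norm : is_norm N)
    (N_submult : submultiplicative mu N)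
    (Q : cubic (ground_field R g) m) :
  (forall s t : R, 0 <= s -> s < t -> mu_exp_cvg mu I (of_real g (t - s) *: Q))
  /\ generates_time_homogeneous_FA mu
       (fun s t : R => mu_exp mu I (of_real g (t - s) *: Q)).
Proof.
split=> [s t _ _ i j k|]; first
  exact: cvgP (@mu_exp_cvgE _ _ _ _ _ mu_unital _ _).
split; last by move=> s t s' t' _ _ _ _ ->.
exists (fun s t => structure_product (mu_exp mu I (of_real g (t - s) *: Q))).
split=> [s tau t _ s_tau tau_t|s t _ _]; last exact: structure_product_matrix.
(* The addition formula applies to t - s = (tau - s) + (t - tau), both terms being nonnegative. *)
by rewrite -mu_expD ?subr_ge0 ?ltW // [tau - s + _]addrC addrA subrK.
Qed.
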